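(* If there is an absolutely rigid Souslin tree, then there is an absolutely rigid Souslin tree that is not totally rigid.
   Context: A Souslin tree is a normal $\omega_1$-tree (countable levels, every node has at least two immediate successors, limit nodes determined by predecessors, every node has successors at every higher level) with no uncountable antichain. Forcing with a tree uses the reversed order. $T$ is rigid if it has no nontrivial automorphism; absolutely rigid if $1\Vdash_T$ ''$T$ is rigid''; totally rigid if $T_p\not\cong T_q$ for all distinct nodes $p,q$, where $T_p=\{r: r\ge_T p\}$. *)

(* Defs.v *)
From HB Require Import structures.
From mathcomp Require Import all_boot all_order.
From mathcomp Require Import boolp classical_sets functions cardinality.

Set Implicit Arguments.
Unset Strict Implicit.
Unset Printing Implicit Defensive.

Import Order.TTheory.
Local Open Scope classical_set_scope.
Local Open Scope order_scope.

Definition order_iso {d d' : Order.disp_t} {T : porderType d}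
    {U : porderType d'} (A : set T) (B : set U) : Prop :=
  exists f : T -> U,
    set_bij A B f /\ {in A &, {mono f : x y / x <= y}}.

Definition well_ordered {d : Order.disp_t} {T : porderType d} (A : set T) :=
  forall B : set T, B `<=` A -> B !=set0 ->
    exists2 m, B m & forall y, B y -> m <= y.

(* Strict initial segment: the predecessors of a node, or the ordinal a seen
   as the set of smaller ordinals. *)
Definition below {d : Order.disp_t} {T : porderType d} (x : T) : set T :=
  [set y | y < x].

(* The ordinal omega_1, up to isomorphism. *)
Definition is_omega1 {d : Order.disp_t} (W : porderType d) : Prop :=
  [/\ well_ordered [set: W],
      ~ countable [set: W] &
      forall a : W, countable (below a)].

Definition limit_ordinal {d : Order.disp_t} {W : porderType d} (a : W) :=
  below a !=set0 /\ forall b, b < a -> exists2 c, b < c & c < a.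

Section Trees.
Context {d : Order.disp_t} (T : porderType d).

Definition is_tree : Prop := forall x : T, well_ordered (below x).

Definition level {dW : Order.disp_t} {W : porderType dW} (a : W) : set T :=
  [set x | order_iso (below x) (below a)].

Definition immediate_succ (x y : T) : Prop :=
  x < y /\ ~ exists2 z, x < z & z < y.

(* The root is the weakest condition 1 of the associated forcing. *)
Definition normal_omega1_tree : Prop :=
  is_tree /\
  (exists r : T, forall x, r <= x) /\
  (forall x : T, exists y z, [/\ y <> z, immediate_succ x y &
                                 immediate_succ x z]) /\
  exists (dW : Order.disp_t) (W : porderType dW),
    is_omega1 W /\
    (forall x : T, exists a : W, level a x) /\
    (forall a : W, level a !=set0) /\
    (forall a : W, countable (level a)) /\
    (forall a : W, limit_ordinal a ->
       forall x y, level a x -> level a y -> below x = below y -> x = y) /\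
    (forall (a b : W) (x : T), a < b -> level a x ->
       exists2 y, x < y & level b y).

Definition antichain (A : set T) : Prop :=
  forall x y, A x -> A y -> x <> y -> x >< y.

Definition souslin_tree : Prop :=
  normal_omega1_tree /\ forall A : set T, antichain A -> countable A.

Definition rigid : Prop :=
  forall f : T -> T,
    bijective f -> {mono f : x y / x <= y} -> forall x, f x = x.

Definition cone (p : T) : set T := [set r | p <= r].

Definition totally_rigid : Prop :=
  forall p q : T, p <> q -> ~ order_iso (cone p) (cone q).

End Trees.

(* Statements about elements and subsets of ground-model sets. Quantified
   variables are bound by functions, and [S X] is the domain of the variables
   for subsets of X: the actual subsets when the statement is read in V, the
   names of subsets when it is read in the forcing language. [Ground A] is an
   absolute assertion A about (canonical names of) ground-model objects. *)
Inductive formula (S : Type -> Type) : Type :=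
| Ground (A : Prop)
| In (X : Type) (x : X) (A : S X)
| Not (phi : formula S)
| And (phi psi : formula S)
| All (X : Type) (phi : X -> formula S)
| AllSub (X : Type) (phi : S X -> formula S).
Arguments Ground {S} A.

Definition Imp S (phi psi : formula S) := Not (And phi (Not psi)).
Definition Iff S (phi psi : formula S) := And (Imp phi psi) (Imp psi phi).
Definition Ex S (X : Type) (phi : X -> formula S) :=
  Not (All (fun x => Not (phi x))).

Fixpoint sat (phi : formula set) : Prop :=
  match phi with
  | Ground A => A
  | In _ x A => A x
  | Not phi => ~ sat phi
  | And phi psi => sat phi /\ sat psi
  | All _ phi => forall x, sat (phi x)
  | AllSub _ phi => forall A, sat (phi A)
  end.

Section Forcing.
Context {d : Order.disp_t} (P : porderType d).

(* A P-name of a subset of X: a set of pairs (canonical name of x, p). Every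
   subset of X in a generic extension by P has a name of this form. *)
Definition subset_name (X : Type) : Type := set (X * P).

(* The forcing relation; q <= p means that q is a stronger condition. *)
Fixpoint force (phi : formula subset_name) (p : P) : Prop :=
  match phi with
  | Ground A => A
  | In _ x A =>
      forall q, q <= p -> exists2 r, r <= q & exists2 s, A (x, s) & r <= s
  | Not phi => forall q, q <= p -> ~ force phi q
  | And phi psi => force phi p /\ force psi p
  | All _ phi => forall x, force (phi x) p
  | AllSub _ phi => forall A, force (phi A) p
  end.

Lemma force_mono (phi : formula subset_name) (p q : P) :
  q <= p -> force phi p -> force phi q.
Proof.
elim: phi p q => [A|X x A|phi _|phi IHphi psi IHpsi|X phi IH|X phi IH] p q qp
  //=.
- by move=> h r rq; apply: h; exact: le_trans qp.
- by move=> h r rq; apply: h; exact: le_trans qp.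
- by move=> [h1 h2]; split; [exact: IHphi h1|exact: IHpsi h2].
- by move=> h x; exact: IH (h x).
- by move=> h A; exact: IH (h A).
Qed.

(* 1 ||- phi: by [force_mono], it suffices that the root forces phi. *)
Definition forced (phi : formula subset_name) : Prop :=
  forall p : P, force phi p.

End Forcing.

Section RigidFormula.
Context {d : Order.disp_t} (T : porderType d) (S : Type -> Type).

Definition automorphism_formula (F : S (T * T)%type) : formula S :=
  And (All (fun x => Ex (fun y => In (x, y) F)))
 (And (All (fun y => Ex (fun x => In (x, y) F)))
 (And (All (fun x => All (fun y => All (fun y' =>
         Imp (And (In (x, y) F) (In (x, y') F)) (Ground (y = y'))))))
 (And (All (fun x => All (fun x' => All (fun y =>
         Imp (And (In (x, y) F) (In (x', y) F)) (Ground (x = x'))))))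
      (All (fun x => All (fun y => All (fun x' => All (fun y' =>
         Imp (And (In (x, y) F) (In (x', y') F))
             (Iff (Ground (x <= x')) (Ground (y <= y'))))))))))).

Definition rigid_formula : formula S :=
  AllSub (fun F : S (T * T)%type =>
    Imp (automorphism_formula F) (All (fun x => In (x, x) F))).

End RigidFormula.

Lemma sat_rigid_formula (d : Order.disp_t) (T : porderType d) :
  sat (rigid_formula T set) <-> rigid T.
Proof.
have impE (A B : Prop) : ~ (A /\ ~ B) <-> (A -> B).
  split=> [h a|h [a nb]]; last exact: nb (h a).
  by apply: contrapT => nb; apply: h.
have exE (X : Type) (A : X -> Prop) : ~ (forall x, ~ A x) <-> exists x, A x.
  split=> [h|[x ax] h]; last exact: h x ax.
  by apply: contrapT => h'; apply: h => x ax; apply: h'; exists x.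
split=> /= [h f [g fK gK] fm x|h F].
  have /impE/(_ _ x) := h [set u | f u.1 = u.2]; apply => /=.
  split; first by move=> y; apply/exE; exists (f y).
  split; first by move=> y; apply/exE; exists (g y).
  split; first by move=> y z z'; apply/impE => -[<- <-].
  split; first by move=> y y' z; apply/impE => -[<-] /(can_inj fK).
  move=> y z y' z'; apply/impE => -[<- <-].
  by split; apply/impE; rewrite fm.
apply/impE => -[Ft [Fs [Ff [Fi Fo]]]] x.
have /choice[f fF] y : exists z, F (y, z) by apply/exE; exact: Ft.
have /choice[g gF] y : exists z, F (z, y) by apply/exE; exact: Fs.
have fE y z : F (y, z) -> f y = z.
  by move=> Fyz; have /impE := Ff y (f y) z; apply.
have fK : cancel f g.
  by move=> y; have /impE := Fi (g (f y)) y (f y); apply.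
have gK : cancel g f by move=> y; exact: fE.
rewrite -{2}[x](h f) //; first by exists g.
move=> y z; have /impE/(_ (conj (fF y) (fF z)))[/impE h1 /impE h2] :=
  Fo y (f y) z (f z).
by apply/idP/idP.
Qed.

(* Forcing with a tree uses the reversed order. *)
Definition absolutely_rigid {d : Order.disp_t} (T : porderType d) : Prop :=
  forced (rigid_formula T (subset_name T^d)).

(* Main.v *)
(** From a tree [T] form the comb: a spine [c_0 < c_1 < ...] of order type
    omega with a copy of [T] directly above each [c_n], and no node above the
    whole spine. Shifting the spine shows that the cones of [c_0] and [c_1] are
    isomorphic. Let [g] be an automorphism of the comb in a generic extension
    in which [T] is rigid. If [g] fixes [c_n], then it either fixes [c_(n+1)]
    or maps it to the root of the [n]-th copy of [T]; in the latter case the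
    comb, being isomorphic to the cone of [c_(n+1)], is isomorphic to [T], hence
    rigid. So [g] fixes the spine in all cases, it preserves each copy of [T],
    and it is the identity there by rigidity of [T]. Below a node of a copy of
    [T], forcing with the comb amounts to forcing with [T]. *)

From HB Require Import structures.
Require Import Defs.
From mathcomp Require Import all_boot all_order.
From mathcomp Require Import boolp classical_sets functions cardinality.

Set Implicit Arguments.
Unset Strict Implicit.
Unset Printing Implicit Defensive.

Import Order.TTheory.
Local Open Scope classical_set_scope.
Local Open Scope order_scope.

(** * Generic isomorphisms and the forcing of rigidity *)

Section GenericIso.
Context {dP : Order.disp_t} (P : porderType dP).

(* [R x y q] stands for "[q] forces that [x] is mapped to [y]"; that [R] is
   functional and injective follows from the last clause by antisymmetry. *)
Definition generic_iso {dA dB : Order.disp_t} {A : porderType dA}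
    {B : porderType dB} (R : A -> B -> set P) (p : P) : Prop :=
  [/\ forall x y q r, r <= q -> R x y q -> R x y r,
      forall x q, q <= p -> exists2 r, r <= q & exists y, R x y r,
      forall y q, q <= p -> exists2 r, r <= q & exists x, R x y r &
      forall q x y x' y', q <= p -> R x y q -> R x' y' q ->
        (x <= x') = (y <= y')].

(** A single [r] below [p] suffices: [generic_iso] passes to stronger conditions, so using this
    below every [q <= p] makes the conditions [r] with [R x x r] dense below [p]. *)
Definition generically_rigid {dA : Order.disp_t} (A : porderType dA) : Prop :=
  forall p (R : A -> A -> set P), generic_iso R p ->
    forall x, exists2 r, r <= p & R x x r.

Section Basic.
Context {dA dB dC : Order.disp_t} {A : porderType dA} {B : porderType dB}
  {C : porderType dC}.

Lemma generic_iso_le (R : A -> B -> set P) p q :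
  q <= p -> generic_iso R p -> generic_iso R q.
Proof.
move=> qp [Rm Rt Rs Ro]; split=> //.
- by move=> x r rq; apply: Rt; exact: le_trans qp.
- by move=> x r rq; apply: Rs; exact: le_trans qp.
- by move=> r x y x' y' rq; apply: Ro; exact: le_trans qp.
Qed.

Lemma generic_iso_fun (R : A -> B -> set P) p x y y' :
  generic_iso R p -> R x y p -> R x y' p -> y = y'.
Proof.
move=> [_ _ _ Ro] h h'; apply: le_anti.
by rewrite -(Ro _ _ _ _ _ (lexx p) h h') -(Ro _ _ _ _ _ (lexx p) h' h) lexx.
Qed.

Lemma generic_iso_lt (R : A -> B -> set P) p x y x' y' :
  generic_iso R p -> R x y p -> R x' y' p -> (x < x') = (y < y').
Proof.
move=> [_ _ _ Ro] h h'.
by rewrite !lt_leAnge (Ro _ _ _ _ _ (lexx p) h h') (Ro _ _ _ _ _ (lexx p) h' h).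
Qed.

Lemma generic_iso_inv (R : A -> B -> set P) p :
  generic_iso R p -> generic_iso (fun y x => R x y) p.
Proof.
move=> [Rm Rt Rs Ro]; split=> //; first by move=> x y; exact: Rm.
by move=> q x y x' y' qp h h'; rewrite (Ro _ _ _ _ _ qp h h').
Qed.

Lemma generic_iso_comp (R : A -> B -> set P) (S : B -> C -> set P) p :
  generic_iso R p -> generic_iso S p ->
  generic_iso (fun x z => [set q | exists2 y, R x y q & S y z q]) p.
Proof.
move=> [Rm Rt Rs Ro] [Sm St Ss So]; split.
- move=> x z q r rq [y Rxy Syz]; exists y; [exact: Rm Rxy|exact: Sm Syz].
- move=> x q qp; have [r rq [y Rxy]] := Rt x q qp.
  have [s sr [z Syz]] := St y r (le_trans rq qp).
  exists s; first exact: le_trans rq.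
  by exists z; exists y => //; exact: Rm Rxy.
- move=> z q qp; have [r rq [y Syz]] := Ss z q qp.
  have [s sr [x Rxy]] := Rs y r (le_trans rq qp).
  exists s; first exact: le_trans rq.
  by exists x; exists y => //; exact: Sm Syz.
- move=> q x z x' z' qp [y Rxy Syz] [y' Rxy' Syz'].
  by rewrite (Ro _ _ _ _ _ qp Rxy Rxy') (So _ _ _ _ _ qp Syz Syz').
Qed.

End Basic.

(** Serves to restrict a generic map to the parts parametrised by [i] and [j]; the two closure
    hypotheses keep the map and its inverse inside these parts. *)
Lemma generic_iso_restr {dA dB dA' dB' : Order.disp_t} {A : porderType dA}
    {B : porderType dB} {A' : porderType dA'} {B' : porderType dB'}
    (i : A' -> A) (j : B' -> B) (R : A -> B -> set P) p :
  {mono i : x y / x <= y} -> {mono j : x y / x <= y} ->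
  (forall x' y q, q <= p -> R (i x') y q -> exists y', y = j y') ->
  (forall x y' q, q <= p -> R x (j y') q -> exists x', x = i x') ->
  generic_iso R p -> generic_iso (fun x' y' => R (i x') (j y')) p.
Proof.
move=> im jm ij ji [Rm Rt Rs Ro]; split.
- by move=> x y; exact: Rm.
- move=> x q qp; have [r rq [y Rxy]] := Rt (i x) q qp; exists r => //.
  have [y' E] := ij _ _ _ (le_trans rq qp) Rxy.
  by exists y'; rewrite -E.
- move=> y q qp; have [r rq [x Rxy]] := Rs (j y) q qp; exists r => //.
  have [x' E] := ji _ _ _ (le_trans rq qp) Rxy.
  by exists x'; rewrite -E.
- move=> q x y x' y' qp h h'.
  by rewrite -im -jm; exact: Ro h h'.
Qed.

(** Conjugating [R] by [H] gives a generic automorphism of [B], which fixes the image [v] of [x]; as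
    [H] is injective, [R] fixes [x]. *)
Lemma generically_rigid_transfer {dA dB : Order.disp_t} {A : porderType dA}
    {B : porderType dB} (H : A -> B -> set P) (R : A -> A -> set P) p :
  generically_rigid B -> generic_iso H p -> generic_iso R p ->
  forall x, exists2 r, r <= p & R x x r.
Proof.
move=> rB Hiso Riso x.
have [Hm Ht _ _] := Hiso; have [Rm _ _ _] := Riso.
have [q qp [v Hxv]] := Ht x p (lexx p).
have HqI := generic_iso_inv (generic_iso_le qp Hiso).
have := generic_iso_comp HqI (generic_iso_comp (generic_iso_le qp Riso)
  (generic_iso_le qp Hiso)).
case/rB/(_ v) => r rq [x1 h1 [x2 h2 h3]].
have HrI := generic_iso_le rq HqI.
have hx : H x v r by exact: Hm Hxv.
exists r; first exact: le_trans qp.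
by rewrite {1}(generic_iso_fun HrI hx h1) (generic_iso_fun HrI hx h3).
Qed.

Section Forcing.
Context {dT : Order.disp_t} (T : porderType dT).

Let impE (phi psi : formula (subset_name P)) p :
  force (Imp phi psi) p <->
  forall q, q <= p -> force phi q -> exists2 r, r <= q & force psi r.
Proof.
split=> /= h q qp.
  move=> hq; apply: contrapT => nex; apply: (h q qp); split=> // r rq hr.
  by apply: nex; exists r.
by move=> [hq nr]; have [r rq hr] := h q qp hq; exact: nr hr.
Qed.

Let exE (X : Type) (phi : X -> formula (subset_name P)) p :
  force (Ex phi) p <->
  forall q, q <= p -> exists2 r, r <= q & exists x, force (phi x) r.
Proof.
split=> /= h q qp.
  apply: contrapT => nex; apply: (h q qp) => x r rq hx.
  by apply: nex; exists r => //; exists x.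
by move=> nx; have [r rq [x hx]] := h q qp; exact: nx hx.
Qed.

(** The truth of a [Ground] formula does not depend on the condition, so the order clause, once
    forced by some stronger condition, holds outright. *)
Lemma force_automorphismP (F : subset_name P (T * T)%type) p :
  force (automorphism_formula F) p <->
  generic_iso (fun x y => force (In (x, y) F)) p.
Proof.
split.
  move=> [Ft [Fs [_ [_ Fo]]]]; split.
  - by move=> x y q r; exact: force_mono.
  - by move=> x; apply/exE; exact: Ft.
  - by move=> x; apply/exE; exact: Fs.
  - move=> q x y x' y' qp h h'.
    have {}Fo : force (Imp (And (In (x, y) F) (In (x', y') F))
        (Iff (Ground (x <= x')) (Ground (y <= y')))) p by exact: Fo.
    have [r rq [h1 h2]] := (impE _ _ _).1 Fo q qp (conj h h').
    have k1 := (impE (Ground _) (Ground _) r).1 h1 r (lexx r).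
    have k2 := (impE (Ground _) (Ground _) r).1 h2 r (lexx r).
    by apply/idP/idP => [/k1[]|/k2[]].
move=> iso; have [Rm Rt Rs Ro] := iso.
split; first by move=> x; apply/exE; exact: Rt.
split; first by move=> x; apply/exE; exact: Rs.
split.
  move=> x y y'; rewrite -/(force _ _); apply/impE => q qp [h h']; exists q => //=.
  exact: generic_iso_fun (generic_iso_le qp iso) h h'.
split.
  move=> x x' y; rewrite -/(force _ _); apply/impE => q qp [h h']; exists q => //=.
  exact: generic_iso_fun (generic_iso_inv (generic_iso_le qp iso)) h h'.
move=> x y x' y'; rewrite -/(force _ _); apply/impE => q qp [h h']; exists q => //.
by split; apply/impE => r rq /= hr; exists r => //;
  rewrite ?(Ro _ _ _ _ _ qp h h') // -(Ro _ _ _ _ _ qp h h').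
Qed.

(** Forcing [In] is a density statement, while [R x y] need not contain every condition below which
    it is dense; hence the density on the right. *)
Lemma force_In_rel (R : T -> T -> set P) x y q :
  (forall x y q r, r <= q -> R x y q -> R x y r) ->
  force (In (x, y) ([set u | R u.1.1 u.1.2 u.2] : subset_name P _)) q <->
  forall q', q' <= q -> exists2 r, r <= q' & R x y r.
Proof.
move=> Rm; split=> /= h q' q'q; have [r rq'] := h q' q'q.
  by move=> [s /= Rs rs]; exists r => //; exact: Rm Rs.
by move=> Rr; exists r => //; exists r.
Qed.

Lemma forced_rigidP :
  forced (rigid_formula T (subset_name P)) <-> generically_rigid T.
Proof.
split=> [rT p R Riso x|rT p F].
  have [Rm Rt Rs Ro] := Riso.
  pose F : subset_name P (T * T)%type := [set u | R u.1.1 u.1.2 u.2].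
  have : force (Imp (automorphism_formula F) (All (fun x => In (x, x) F))) p.
    exact: rT.
  move=> /impE/(_ p (lexx p))[|q qp hq].
    apply/force_automorphismP; split.
    - by move=> ? ? ? ?; exact: force_mono.
    - move=> y q qp; have [r rq [z h]] := Rt y q qp; exists r => //; exists z.
      by apply/force_In_rel => // s sr; exists s => //; exact: Rm h.
    - move=> y q qp; have [r rq [z h]] := Rs y q qp; exists r => //; exists z.
      by apply/force_In_rel => // s sr; exists s => //; exact: Rm h.
    - move=> q y z y' z' qp /(force_In_rel _ _ _ Rm) h /(force_In_rel _ _ _ Rm) h'.
      have [r rq hr] := h q (lexx q); have [s sr hs] := h' r rq.
      by apply: (Ro s) => //; [exact: le_trans (le_trans rq qp)|exact: Rm hr].
  have /(force_In_rel _ _ _ Rm)/(_ q (lexx q))[r rq Rr] := hq x.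
  by exists r => //; exact: le_trans qp.
rewrite -/(force _ _); apply/impE => q qp /force_automorphismP Fiso; exists q => // x q' q'q.
have [r rq' hr] := rT q' _ (generic_iso_le q'q Fiso) x.
have [s sr [t Ft st]] := hr r (lexx r).
by exists s; [exact: le_trans rq'|exists t].
Qed.

End Forcing.

End GenericIso.

(** A generic automorphism below [q] is pulled back along [e], which identifies [P] with a downward
    closed part of [Q] that contains a condition below [q]. *)
Lemma generically_rigid_cone {dP dQ dA : Order.disp_t} {P : porderType dP}
    {Q : porderType dQ} (A : porderType dA) :
  (forall q : Q, exists2 e : P -> Q, {mono e : x y / x <= y} &
     (exists p, e p <= q) /\ forall p r, r <= e p -> exists p', r = e p') ->
  generically_rigid P A -> generically_rigid Q A.
Proof.
move=> cov rA q R Riso x; have [e em [[p epq] ecl]] := cov q.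
have [Rm Rt Rs Ro] := generic_iso_le epq Riso.
have [] := rA p (fun x y => [set p' | R x y (e p')]) _ x.
  split.
  - by move=> y z s r rs /=; apply: Rm; rewrite em.
  - move=> y s sp; have [|r rs [z Rr]] := Rt y (e s); first by rewrite em.
    have [r' E] := ecl _ _ rs.
    by exists r'; [rewrite -em -E|exists z; rewrite /= -E].
  - move=> y s sp; have [|r rs [z Rr]] := Rs y (e s); first by rewrite em.
    have [r' E] := ecl _ _ rs.
    by exists r'; [rewrite -em -E|exists z; rewrite /= -E].
  - by move=> s y z y' z' sp; apply: Ro; rewrite em.
by move=> r rp Rr; exists (e r) => //; apply: le_trans epq; rewrite em.
Qed.

(** * Countable sets, well-orders, ranks, and a level-free form of Souslin trees *)

Lemma countable_preim_inj (T U : Type) (f : T -> U) (A : set T) (B : set U) :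
  {in A &, injective f} -> (forall x, A x -> B (f x)) ->
  countable B -> countable A.
Proof.
move=> fI fAB /countable_injP[g gI]; apply/countable_injP.
exists (g \o f) => x y xA yA /= /gI E; apply: fI => //.
by apply: E; rewrite inE; apply: fAB; rewrite -inE.
Qed.

Lemma countable_subset (T : Type) (A B : set T) :
  A `<=` B -> countable B -> countable A.
Proof. by move=> AB; apply: sub_countable; exact: subset_card_le. Qed.

Lemma countable_setU (T : Type) (A B : set T) :
  countable A -> countable B -> countable (A `|` B).
Proof.
by move=> cA cB; rewrite -bigcup2E; apply: bigcup_countable => // -[|[|n]] _.
Qed.

Section WellOrder.
Context {dW : Order.disp_t} {W : porderType dW}.
Hypothesis wo : well_ordered [set: W].

Lemma well_ordered_leVlt (a b : W) : a <= b \/ b < a.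
Proof.
have [//||m /= [->|->] mle] := wo (B := [set x | x = a \/ x = b]) _ _.
- by exists a; left.
- by left; apply: mle; right.
- have [->|ne] := eqVneq a b; [by left|right].
  by rewrite lt_neqAle eq_sym ne; apply: mle; left.
Qed.

Lemma below_iso_inj (a b : W) : order_iso (below a) (below b) -> a = b.
Proof.
(* As [f y < y], there is a least [z] with [f z < z]; but then [f (f z) < f z] contradicts its
   minimality. *)
have key x y (f : W -> W) : y < x -> (forall z, z < x -> f z < y) ->
    (forall z t, z < x -> t < x -> (f z <= f t) = (z <= t)) -> False.
  move=> yx fy fm.
  have [//||z [zx fz] zmin] := wo (B := [set z | z < x /\ f z < z]) _ _.
    by exists y; split=> //; exact: fy.
  have fzx : f z < x by exact: lt_trans zx.
  suff /zmin : f z < x /\ f (f z) < f z by rewrite (lt_geF fz).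
  by split=> //; rewrite lt_leAnge !fm // -lt_leAnge.
move=> [f [[fab fi fs] fm]].
have {}fm z t : z < a -> t < a -> (f z <= f t) = (z <= t).
  by move=> za ta; apply: fm; rewrite inE.
have [|ab] := well_ordered_leVlt a b; last first.
  by case: (key a b f ab).
rewrite le_eqVlt => /predU1P[//|ab].
have /choice[g gP] z : exists t, z < b -> t < a /\ f t = z.
  have [zb|nzb] := pselect (z < b); last by exists z.
  by have [t /= ta ft] := fs z zb; exists t.
case: (key b a g ab) => [z /gP[]//|z t zb tb].
have [ga fg] := gP z zb; have [ga' fg'] := gP t tb.
by rewrite -fm // fg fg'.
Qed.

End WellOrder.

Section Rank.
Context {dW dT : Order.disp_t} {W : porderType dW} {T : porderType dT}.
Hypothesis W1 : is_omega1 W.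

(** The inverse of one isomorphism followed by the other identifies [below a] with [below b], and
    distinct initial segments of a well-order are not isomorphic. *)
Lemma level_unique (a b : W) (x : T) : level a x -> level b x -> a = b.
Proof.
have [wo _ _] := W1.
move=> [f [[fXY fi fs] fm]] [g [[gXZ gi gs] gm]]; apply: (below_iso_inj wo).
have /choice[h hP] u : exists y, u < a -> y < x /\ f y = u.
  have [/fs[y /= yx fy]|nu] := pselect (u < a); first by exists y.
  by exists x.
exists (g \o h).
have hlt u : below a u -> h u \in below x by move=> /hP[]; rewrite inE.
have mono u v : below a u -> below a v -> (g (h u) <= g (h v)) = (u <= v).
  move=> ua va; rewrite gm ?hlt // -fm ?hlt //.
  by have [_ ->] := hP u ua; have [_ ->] := hP v va.
split; last by move=> u v /set_mem ua /set_mem va; exact: mono.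
split.
- by move=> u /hP[hu _]; exact: gXZ.
- move=> u v /set_mem ua /set_mem va /= E; apply: le_anti.
  by rewrite -(mono u v) // -(mono v u) // E lexx.
- move=> v /gs[y yx <-]; exists (f y); first exact: fXY.
  have [hy fy] := hP _ (fXY _ yx).
  by rewrite /= (fi _ _ _ _ fy) // inE.
Qed.

(** Without a strict upper bound, [W] would be a countable union of closed initial segments, each
    countable. *)
Lemma omega1_bounded (I : Type) (D : set I) (f : I -> W) :
  countable D -> exists2 a, (forall i, D i -> f i < a) &
    forall b, (forall i, D i -> f i < b) -> a <= b.
Proof.
have [wo Wunc Wbel] := W1; move=> Dc.
have [//||a aP amin] := wo [set a | forall i, D i -> f i < a]; last by exists a.
apply: contrapT => nex; apply: Wunc.
apply: (@countable_subset _ _ (\bigcup_(i in D) (f i |` below (f i)))).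
  move=> a _; have [i Di nlt] : exists2 i, D i & ~ f i < a.
    apply: contrapT => nex'; apply: nex; exists a => i Di.
    by apply: contrapT => ?; apply: nex'; exists i.
  exists i => //; have [|//] := well_ordered_leVlt wo a (f i).
  by rewrite le_eqVlt => /predU1P[|]; [left|right].
apply: bigcup_countable => // i _.
exact: countable_setU.
Qed.

Hypothesis Ttree : is_tree T.
Hypothesis Tbelow : forall x : T, countable (below x).

(** An inaccessible node has an inaccessible predecessor, which contradicts the choice of a least
    inaccessible node below [x]. *)
Lemma tree_lt_wf : well_founded (fun x y : T => x < y).
Proof.
move=> x; apply: contrapT => nx.
have step y : ~ Acc (fun x y : T => x < y) y ->
    exists2 z, z < y & ~ Acc (fun x y : T => x < y) z.
  move=> ny; apply: contrapT => nex; apply: ny; constructor=> z zy.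
  by apply: contrapT => nz; apply: nex; exists z.
have [z zx nz] := step x nx.
have [||m [mx nm] mmin] := Ttree (x := x)
  (B := [set y | y < x /\ ~ Acc (fun x y : T => x < y) y]) _ _.
- by move=> y [].
- by exists z.
- have [y ym ny] := step m nm.
  have /mmin : y < x /\ ~ Acc (fun x y : T => x < y) y.
    by split=> //; exact: lt_trans mx.
  by rewrite (lt_geF ym).
Qed.

Lemma tree_below_total (x y z : T) : y <= x -> z <= x -> y <= z \/ z < y.
Proof.
rewrite !le_eqVlt => /predU1P[->|yx] /predU1P[->|zx].
- by left; rewrite eqxx.
- by right.
- by left; rewrite yx orbT.
have [||m /= [->|->] mle] := Ttree (x := x) (B := [set u | u = y \/ u = z]) _ _.
- by move=> u [->|->].
- by exists y; left.
- by left; rewrite -le_eqVlt; apply: mle; right.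
- have [->|ne] := eqVneq y z; [by left|right].
  by rewrite lt_neqAle eq_sym ne; apply: mle; left.
Qed.

Lemma tree_rank : exists rho : T -> W,
  (forall x y, y < x -> rho y < rho x) /\
  (forall x b, b < rho x -> exists2 y, y < x & rho y = b).
Proof.
have [wo Wunc _] := W1.
have [w0 _] : [set: W] !=set0.
  by apply/set0P/negP => /eqP W0; apply: Wunc; rewrite W0.
(* The rank is the least strict upper bound of the ranks of the predecessors. The default [w0] is
   never taken by [rho], by [omega1_bounded]. *)
pose sup (x : T) (f : forall y, y < x -> W) := xget w0
  [set a | (forall y (h : y < x), f y h < a) /\
           forall b, (forall y (h : y < x), f y h < b) -> a <= b].
pose rho := Fix tree_lt_wf (fun _ => W) sup.
have rhoE x : rho x = sup x (fun y _ => rho y).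
  rewrite /rho Fix_eq // => y f g fg; congr sup.
  by apply: functional_extensionality_dep => z;
     apply: functional_extensionality_dep => h; exact: fg.
have rhoP x : (forall y, y < x -> rho y < rho x) /\
    forall b, (forall y, y < x -> rho y < b) -> rho x <= b.
  rewrite [rho x]rhoE /sup; case: xgetP => [a _ []//|nex].
  by have [a a1 a2] := omega1_bounded rho (Tbelow x); case: (nex a).
exists rho; split=> [x|x b bx]; first by have [] := rhoP x.
(* If no predecessor had rank at least [b], then [b] would be a strict bound and [rho x <= b]. The
   least such predecessor has rank exactly [b]. *)
have [y yx byP] : exists2 y, y < x & b <= rho y.
  apply: contrapT => nex; have : rho x <= b.
    apply: (rhoP x).2 => y yx; have [by_|//] := well_ordered_leVlt wo b (rho y).
    by case: nex; exists y.
  by rewrite (lt_geF bx).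
have [||m [mx bm] mmin] := Ttree (x := x)
    (B := [set y | y < x /\ b <= rho y]) _ _.
- by move=> z [].
- by exists y.
exists m => //; apply: le_anti; rewrite bm andbT; apply: (rhoP m).2 => z zm.
have [bz|//] := well_ordered_leVlt wo b (rho z).
have /mmin : z < x /\ b <= rho z by split=> //; exact: lt_trans mx.
by rewrite (lt_geF zm).
Qed.

Lemma rank_level (rho : T -> W) :
  (forall x y, y < x -> rho y < rho x) ->
  (forall x b, b < rho x -> exists2 y, y < x & rho y = b) ->
  forall x, level (rho x) x.
Proof.
move=> rm rs x; exists rho.
have mono : {in below x &, {mono rho : y z / y <= z}}.
  move=> y z /set_mem /= yx /set_mem /= zx.
  have [yz|zy] := tree_below_total (ltW yx) (ltW zx).
    rewrite yz; move: yz; rewrite le_eqVlt => /predU1P[->|/rm/ltW//].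
    exact: lexx.
  by rewrite (lt_geF (rm _ _ zy)) (lt_geF zy).
split=> //; split.
- by move=> y; exact: rm.
- move=> y z yx zx E; apply: le_anti.
  by rewrite -(mono y z) // -(mono z y) // E lexx.
- by move=> b /rs[y yx <-]; exists y.
Qed.

End Rank.

(* The well-founded rank takes over the role of the levels: a level is an
   antichain, and an uncountable cone cannot lie in countably many levels. *)
Lemma souslin_treeP {dT : Order.disp_t} (T : porderType dT) :
  souslin_tree T <->
  (exists (dW : Order.disp_t) (W : porderType dW), is_omega1 W) /\
  [/\ is_tree T /\ (exists r : T, forall x, r <= x),
      forall x : T, exists y z, [/\ y <> z, immediate_succ x y &
                                    immediate_succ x z],
      forall x : T, countable (below x) /\ ~ countable (cone x),
      forall x y : T, below x !=set0 ->
        (forall z, z < x -> exists2 t, z < t & t < x) ->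
        below x = below y -> x = y &
      forall A : set T, antichain A -> countable A].
Proof.
split.
  move=> [[Ttree [Troot [Tsucc [dW [W [W1 [Tlev [Lne [Lc [Llim Lext]]]]]]]]]] Tac].
  have [wo Wunc Wbel] := W1.
  split; first by exists dW, W.
  split=> // [x|x y [z0 z0x] xlim E].
    have [a ax] := Tlev x; split.
      have [f [[fab fi _] _]] := ax.
      by apply: (countable_preim_inj fi) (Wbel a) => y; exact: fab.
    move=> cx; apply: Wunc.
    (* A node [y b] above [x] on each level [b] above [a] gives an injection of uncountably many
       ordinals into the cone; elsewhere the value is the default [x]. *)
    have /choice[y yP] b : exists y, a < b -> x < y /\ level b y.
      have [ab|nab] := pselect (a < b); last by exists x.
      by have [y xy yb] := Lext a b x ab ax; exists y.
    apply: (@countable_subset _ _ ((a |` below a) `|` [set b | a < b])).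
      move=> b _; have [|ab] := well_ordered_leVlt wo b a; last by right.
      by rewrite le_eqVlt => /predU1P[|]; left; [left|right].
    apply: countable_setU; first exact: countable_setU.
    apply: (countable_preim_inj (f := y)) cx => [b c|b /yP[/ltW]//].
    move=> /set_mem/yP[_ yb] /set_mem/yP[_ yc] E.
    by apply: (level_unique W1) yb _; rewrite E.
  have [a ax] := Tlev x; have ay : level a y by rewrite /level /= -E.
  apply: (Llim a) => //; have [f [[fab fi fs] fm]] := ax.
  split=> [|b /fs[z /= zx <-]]; first by exists (f z0); exact: fab.
  have [t zt tx] := xlim z zx; exists (f t); last exact: fab.
  by rewrite lt_leAnge !fm ?inE // -lt_leAnge.
move=> [[dW [W W1]] [[Ttree Troot] Tsucc Tc Tlim Tac]].
have [wo Wunc Wbel] := W1.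
have Tbelow x := (Tc x).1.
have [rho [rm rs]] := tree_rank W1 Ttree Tbelow.
have rL := rank_level Ttree rm rs.
have levE a x : level a x -> rho x = a by exact: level_unique.
have Lc (a : W) : countable (level a : set T).
  apply: Tac => x y /levE xa /levE ya nxy; apply/negP => /orP[]; rewrite le_eqVlt.
    by move=> /predU1P[//|/rm]; rewrite xa ya ltxx.
  by move=> /predU1P[E|/rm]; [apply: nxy|rewrite xa ya ltxx].
have Lext b x : exists2 y, x <= y & b <= rho y.
  apply: contrapT => nex; apply: (Tc x).2.
  apply: (@countable_subset _ _ (\bigcup_(c in below b) level c)).
    move=> y xy; exists (rho y) => //=.
    have [by_|//] := well_ordered_leVlt wo b (rho y).
    by case: nex; exists y.
  exact: bigcup_countable.
split=> //; split=> //; split=> //; split=> //.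
exists dW, W; split=> //; split; first by move=> x; exists (rho x).
split.
  move=> a; have [r _] := Troot; have [y _] := Lext a r.
  rewrite le_eqVlt => /predU1P[->|/rs[z _ <-]]; first by exists y.
  by exists z.
split=> //; split.
  move=> a [[b ba] alim] x y ax ay; have [f [[fab fi fs] fm]] := ax.
  apply: Tlim; first by have [z zx _] := fs b ba; exists z.
  move=> z zx; have [c fzc ca] := alim (f z) (fab z zx).
  have [t /= tx E] := fs c ca; exists t => //.
  by rewrite lt_leAnge -!fm ?inE // E -lt_leAnge.
move=> a b x ab /levE xa; have [y xy bY] := Lext b x.
(* [y] may lie above level [b]; then one of its predecessors has rank exactly [b], and it is
   comparable with [x] since both are at most [y]. *)
have [z zy zb] : exists2 z, z <= y & rho z = b.
  move: bY; rewrite le_eqVlt => /predU1P[->|/rs[z /ltW zy <-]].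
    by exists y.
  by exists z.
exists z; last by rewrite -zb.
have [zx|//] := tree_below_total Ttree zy xy.
move: zx; rewrite le_eqVlt => /predU1P[E|/rm].
  by move: ab; rewrite -xa -zb E ltxx.
by rewrite zb xa => /(lt_trans ab); rewrite ltxx.
Qed.

(* [(n, None)] is the [n]-th node of the spine and [(n, Some x)] is the node
   [x] of the copy of [T] hanging directly above it. *)
Definition comb (T : Type) : Type := (nat * option T)%type.
Definition spine {T : Type} (n : nat) : comb T := (n, None).
Definition tooth {T : Type} (n : nat) (x : T) : comb T := (n, Some x).
(** The image of this map is the cone of [spine k], which is thus a copy of the comb. *)
Definition comb_shift {T : Type} (k : nat) (u : comb T) : comb T :=
  ((k + u.1)%N, u.2).

(** * The comb order and its Souslin properties *)

Section CombOrder.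
Context {d : Order.disp_t} (T : porderType d).

HB.instance Definition _ := Choice.copy (comb T) (nat * option T)%type.

Definition comb_le (u v : comb T) : bool :=
  match u.2, v.2 with
  | None, _ => (u.1 <= v.1)%N
  | Some x, Some y => (u.1 == v.1) && (x <= y)
  | Some _, None => false
  end.

Fact comb_le_refl : reflexive comb_le.
Proof. by case=> n [x|] /=; rewrite /comb_le /= ?eqxx ?leqnn ?lexx. Qed.

Fact comb_le_anti : antisymmetric comb_le.
Proof.
move=> [n [x|]] [m [y|]]; rewrite /comb_le //= ?andbF //.
  by move=> /andP[/andP[/eqP-> xy] /andP[_ yx]]; rewrite (@le_anti _ _ x y) ?xy.
by rewrite -eqn_leq => /eqP->.
Qed.

Fact comb_le_trans : transitive comb_le.
Proof.
move=> [m [y|]] [n [x|]] [k [z|]] //; rewrite /comb_le /=.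
- by move=> /andP[/eqP-> xy] /andP[/eqP-> yz]; rewrite eqxx (le_trans xy).
- by move=> nm /andP[/eqP<-].
- exact: leq_trans.
- exact: leq_trans.
Qed.

HB.instance Definition _ := Order.Le_isPOrder.Build d (comb T)
  comb_le_refl comb_le_anti comb_le_trans.

Implicit Types (x y : T) (n m : nat) (u v : comb T).

Lemma le_spine n u : (spine n <= u) = (n <= u.1)%N. Proof. by []. Qed.

Lemma le_tooth n m x y : (tooth n x <= tooth m y) = (n == m) && (x <= y).
Proof. by []. Qed.

Lemma le_tooth_spine n m x : (tooth n x <= spine m) = false.
Proof. by []. Qed.

Lemma lt_spine n m : ((spine n : comb T) < spine m) = (n < m)%N.
Proof. by rewrite lt_leAnge !le_spine /= -ltnNge andb_idl // => /ltnW. Qed.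

Lemma lt_spine_tooth n m y : (spine n < tooth m y) = (n <= m)%N.
Proof. by rewrite lt_leAnge le_tooth_spine andbT. Qed.

Lemma lt_tooth n m x y : (tooth n x < tooth m y) = (n == m) && (x < y).
Proof.
by rewrite !lt_leAnge !le_tooth eq_sym; case: eqP => //= _; rewrite andbF.
Qed.

Lemma lt_tooth_spine n m x : (tooth n x < spine m) = false.
Proof. by rewrite lt_leAnge le_tooth_spine. Qed.

Lemma tooth_le n x v : tooth n x <= v -> exists2 y, v = tooth n y & x <= y.
Proof.
case: v => m [y|] //; rewrite -/(tooth m y) le_tooth => /andP[/eqP-> xy].
by exists y.
Qed.

Lemma le_comb_shift k : {mono @comb_shift T k : u v / u <= v}.
Proof.
move=> [n [x|]] [m [y|]] //; rewrite /Order.le /= /comb_le /= ?leq_add2l //.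
by rewrite eqn_add2l.
Qed.

Definition comb_ltE := (lt_spine, lt_spine_tooth, lt_tooth, lt_tooth_spine).

Lemma combP u : (exists n, u = spine n) \/ (exists n x, u = tooth n x).
Proof. by case: u => n [x|]; [right; exists n, x|left; exists n]. Qed.

Lemma comb_tree : is_tree T -> is_tree (comb T).
Proof.
move=> Ttree u B Bu [v0 Bv0].
(* A spine node in [B] of least index is below all of [B]. If there is none, [B] lies in a single
   tooth, below one of its nodes, and [T] supplies the minimum. *)
have [[n Bn]|nsp] := pselect (exists n, B (spine n)).
  have ex : exists n, `[< B (spine n) >] by exists n; apply/asboolP.
  case: (ex_minnP ex) => m /asboolP Bm mmin; exists (spine m) => // v Bv.
  case: (combP v) Bv => [[k ->]|[k [x ->]]] Bv; rewrite le_spine /=.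
    by apply: mmin; apply/asboolP.
  have [z E _] := tooth_le (ltW (Bu _ Bv)).
  by move: (Bu _ Bm); rewrite /below /= E lt_spine_tooth.
have [[n E]|[n [x0 E]]] := combP v0; first by case: nsp; exists n; rewrite -E.
have Bx0 : B (tooth n x0) by rewrite -E.
have [z uE _] := tooth_le (ltW (Bu _ Bx0)).
have Bt v : B v -> exists2 y, v = tooth n y & y < z.
  case: (combP v) => [[k ->]|[k [x ->]]] Bv; first by case: nsp; exists k.
  move: (Bu _ Bv); rewrite /below /= uE lt_tooth => /andP[/eqP-> xz].
  by exists x.
have [||m Bm mmin] := Ttree z [set y | B (tooth n y)].
- by move=> y /Bt[y' [->]].
- by exists x0.
exists (tooth n m) => // v Bv; have [y yE _] := Bt v Bv.
by rewrite yE le_tooth eqxx; apply: mmin; rewrite /= -yE.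
Qed.

Lemma comb_succ (r : T) :
  (forall x, r <= x) ->
  (forall x, exists y z, [/\ y <> z, immediate_succ x y &
                             immediate_succ x z]) ->
  forall u, exists v w, [/\ v <> w, immediate_succ u v & immediate_succ u w].
Proof.
move=> rP Tsucc u; case: (combP u) => [[n ->]|[n [x ->]]].
  exists (spine n.+1), (tooth n r); split=> //; split; rewrite ?comb_ltE //.
    move=> [v]; case: (combP v) => [[k ->]|[k [x ->]]]; rewrite !comb_ltE //.
    by move=> nk; rewrite ltnS leqNgt nk.
  move=> [v]; case: (combP v) => [[k ->]|[k [x ->]]]; rewrite !comb_ltE //.
    by move=> nk; rewrite leqNgt nk.
  by move=> _ /andP[_]; rewrite (le_gtF (rP x)).
have [y [z [yz [xy ny] [xz nz]]]] := Tsucc x.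
have succ t : immediate_succ x t -> immediate_succ (tooth n x) (tooth n t).
  move=> [xt nt]; split; first by rewrite lt_tooth eqxx.
  move=> [v nv]; have [w vE _] := tooth_le (ltW nv).
  by move: nv; rewrite vE !lt_tooth eqxx /= => xw wt; apply: nt; exists w.
by exists (tooth n y), (tooth n z); split; [case|exact: succ|exact: succ].
Qed.

Lemma comb_below_countable u :
  (forall x, countable (below x)) -> countable (below u).
Proof.
move=> Tc.
(* The union over [x] has at most one term, since [u] determines [x]; it is empty when [u] is on the
   spine. *)
apply: (@countable_subset _ _ (range spine `|`
    \bigcup_(x in [set x | u = tooth u.1 x]) tooth u.1 @` below x)).
  move=> v; case: (combP v) => [[k ->]|[k [x ->]]]; first by left; exists k.
  move=> vu; have [z uE _] := tooth_le (ltW vu); right.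
  rewrite uE /=; exists z => //; move: vu; rewrite /below /= uE lt_tooth eqxx.
  by move=> xz; exists x.
apply: countable_setU.
  by apply: sub_countable (countableP [set: nat]); exact: card_image_le.
apply: bigcup_countable => [|x _].
  apply: (countable_preim_inj (f := fun=> 0%N) (B := [set: nat])) => //.
  by move=> x y /set_mem /= -> /set_mem /= [].
by apply: sub_countable (Tc x); exact: card_image_le.
Qed.

(** At or above every node there is a tooth node, whose cone contains a copy of a cone of [T]. *)
Lemma comb_cone_uncountable (r : T) u :
  (forall x : T, ~ countable (cone x)) -> ~ countable (cone u).
Proof.
move=> Tc.
suff [n [x ux]] : exists n x, u <= tooth n x.
  move=> cu; apply: (Tc x); apply: (countable_preim_inj (f := tooth n)) cu.
    by move=> y z _ _ [].
  by move=> y xy; apply: le_trans ux _; rewrite le_tooth eqxx.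
case: (combP u) => [[n ->]|[n [x ->]]]; first by exists n, r; rewrite le_spine.
by exists n, x.
Qed.

(** Spine nodes are never limits. For tooth nodes, the spine nodes below them determine the index,
    and the rest reduces to [T]. *)
Lemma comb_limit :
  (forall x y, below x !=set0 ->
     (forall z, z < x -> exists2 t, z < t & t < x) ->
     below x = below y -> x = y) ->
  forall u v, below u !=set0 ->
    (forall w, w < u -> exists2 t, w < t & t < u) ->
    below u = below v -> u = v.
Proof.
move=> Tlim.
have spineF n : below (spine n : comb T) !=set0 ->
    (forall w, w < spine n -> exists2 t, w < t & t < (spine n : comb T)) ->
    False.
  move=> [w]; rewrite /below /=.
  case: (combP w) => [[k ->]|[k [x ->]]]; rewrite comb_ltE //.
  case: n => // n _ /(_ (spine n)); rewrite lt_spine => /(_ (leqnn _))[t].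
  case: (combP t) => [[j ->]|[j [x ->]]]; rewrite !comb_ltE //.
  by move=> nj; rewrite ltnS leqNgt nj.
move=> u v u0 ulim E.
have v0 : below v !=set0 by rewrite -E.
have ltE w : (w < u) = (w < v).
  apply/idP/idP => h; first by have : below v w by rewrite -E.
  by have : below u w by rewrite E.
have vlim w : w < v -> exists2 t, w < t & t < v.
  by rewrite -ltE => /ulim[t wt]; rewrite ltE => tv; exists t.
case: (combP u) (combP v) => [[n uE]|[n [x uE]]] [[m vE]|[m [y vE]]]; subst.
- by case: (spineF n).
- by case: (spineF n).
- by case: (spineF m).
have nm : n = m.
  apply/eqP; rewrite eqn_leq; apply/andP; split.
    by have := ltE (spine n); rewrite !comb_ltE leqnn.
  by have := ltE (spine m); rewrite !comb_ltE leqnn.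
rewrite -nm in ltE *; congr tooth; apply: Tlim.
(* A node strictly between [spine n] and [tooth n x] must belong to the tooth, so [x] has a
   predecessor in [T]. *)
- have [|t] := ulim (spine n); first by rewrite comb_ltE.
  case: (combP t) => [[k ->]|[k [z ->]]]; rewrite !comb_ltE.
    by move=> nk; rewrite leqNgt nk.
  by move=> _ /andP[_ zx]; exists z.
- move=> z zx; have [|t] := ulim (tooth n z); first by rewrite comb_ltE eqxx.
  move=> zt; have [t' tE _] := tooth_le (ltW zt).
  by move: zt; rewrite tE !comb_ltE eqxx /=; exists t'.
- apply/funext => z; have := ltE (tooth n z); rewrite !comb_ltE eqxx /=.
  by rewrite /below /= => ->.
Qed.

Lemma comb_antichain :
  (forall A : set T, antichain A -> countable A) ->
  forall A : set (comb T), antichain A -> countable A.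
Proof.
move=> Tac A Aac.
apply: (@countable_subset _ _ (range spine `|`
    \bigcup_n tooth n @` [set x | A (tooth n x)])).
  move=> v; case: (combP v) => [[k ->]|[k [x ->]]]; first by left; exists k.
  by move=> Av; right; exists k => //; exists x.
apply: countable_setU.
  by apply: sub_countable (countableP [set: nat]); exact: card_image_le.
apply: bigcup_countable => // n _.
apply: sub_countable (card_image_le _ _) _; apply: Tac => x y Ax Ay nxy.
have := Aac _ _ Ax Ay; rewrite /Order.comparable !le_tooth eqxx /=.
by apply; case.
Qed.

Lemma comb_not_totally_rigid : ~ totally_rigid (comb T).
Proof.
move=> /(_ (spine 0) (spine 1)); apply=> //.
exists (comb_shift 1); split; last by move=> u v _ _; exact: le_comb_shift.
split.
- by move=> [n a] _.
- by move=> [n a] [m b] _ _ [E ->]; rewrite [n]E.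
- by move=> [[|n] a] // _; exists (n, a).
Qed.

End CombOrder.

Lemma comb_souslin {d : Order.disp_t} (T : porderType d) :
  souslin_tree T -> souslin_tree (comb T).
Proof.
move=> /souslin_treeP[W1 [[Ttree [r rP]] Tsucc Tc Tlim Tac]].
apply/souslin_treeP; split=> //; split.
- split; first exact: comb_tree.
  by exists (spine 0) => u; rewrite le_spine.
- exact: comb_succ rP Tsucc.
- move=> u; split; first by apply: comb_below_countable => x; exact: (Tc x).1.
  by apply: (comb_cone_uncountable r) => x; exact: (Tc x).2.
- exact: comb_limit.
- exact: comb_antichain.
Qed.

(** * Rigidity of the comb in generic extensions *)

Section CombRigid.
Context {dP d : Order.disp_t} (P : porderType dP) (T : porderType d) (r0 : T).
Hypothesis r0P : forall x, r0 <= x.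
Hypothesis rT : generically_rigid P T.

Lemma comb_spine_fixed n p (R : comb T -> comb T -> set P) :
  generic_iso R p -> exists2 q, q <= p & R (spine n) (spine n) q.
Proof.
elim: n p => [|n IHn] p Riso; have [Rm Rt Rs Ro] := Riso.
  have [q qp [y Ry]] := Rt (spine 0) p (lexx p).
  (* The root is sent to [y] and [x] is sent to the root, so [spine 0 <= x] yields
     [y <= spine 0]. *)
  have [r rq [x Rx]] := Rs (spine 0) q qp; exists r; first exact: le_trans qp.
  have Ry' := Rm _ _ _ _ rq Ry.
  have y0 : y <= spine 0 by rewrite -(Ro _ _ _ _ _ (le_trans rq qp) Ry' Rx).
  by rewrite -{2}(_ : y = spine 0) //; apply: le_anti; rewrite y0.
have [p1 p1p Rn] := IHn p Riso.
have [p2 p21 [y Ry]] := Rt (spine n.+1) p1 p1p.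
have p2p := le_trans p21 p1p.
have ny : spine n < y.
  rewrite -(generic_iso_lt (generic_iso_le p2p Riso) (Rm _ _ _ _ p21 Rn) Ry).
  by rewrite lt_spine.
(* Such a [z] comes from some [w] strictly above [spine n] and at most [spine n.+1], hence from
   [spine n.+1] itself. *)
have preim z : spine n < z -> z <= y ->
    exists2 p3, p3 <= p2 & R (spine n.+1) z p3.
  move=> nz zy; have [p3 p32 [w Rw]] := Rs z p2 p2p; exists p3 => //.
  have R3 := generic_iso_le (le_trans p32 p2p) Riso.
  have Rn3 := Rm _ _ _ _ (le_trans p32 p21) Rn.
  have nw : spine n < w by rewrite (generic_iso_lt R3 Rn3 Rw).
  have : w <= spine n.+1.
    by rewrite (Ro _ _ _ _ _ (le_trans p32 p2p) Rw (Rm _ _ _ _ p32 Ry)).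
  case: (combP w) nw Rw => [[k ->]|[k [x ->]]]; last by rewrite le_tooth_spine.
  rewrite lt_spine le_spine /= => nk Rw kn.
  by rewrite (_ : n.+1 = k) //; apply/eqP; rewrite eqn_leq nk.
(* Every node strictly above [spine n] is at or above one of its two immediate successors; by
   [preim], [spine n.+1] is sent to that one. *)
have : spine n.+1 <= y \/ tooth n r0 <= y.
  case: (combP y) ny => [[k ->]|[k [x ->]]]; rewrite comb_ltE => nk.
    by left.
  move: nk; rewrite leq_eqVlt => /predU1P[->|nk]; last by left.
  by right; rewrite le_tooth eqxx r0P.
move=> [] y1.
  have [|p3 p32 Rp3] := preim _ _ y1; first by rewrite lt_spine.
  by exists p3 => //; exact: le_trans p2p.
(* The cone of [spine n.+1] is a copy of the comb and that of [tooth n r0] a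
   copy of [T], so here the comb is generically isomorphic to [T], hence
   generically rigid. *)
have [|p3 p32 Rp3] := preim _ _ y1; first by rewrite lt_spine_tooth.
have p3p := le_trans p32 p2p; have R3 := generic_iso_le p3p Riso.
have Hiso : generic_iso (fun (u : comb T) x =>
    R (comb_shift n.+1 u) (tooth n x)) p3.
  apply: generic_iso_restr R3.
  - exact: le_comb_shift.
  - by move=> x z; rewrite le_tooth eqxx.
  - move=> u v q q3 Ruv.
    have := Ro _ _ _ _ _ (le_trans q3 p3p) (Rm _ _ _ _ q3 Rp3) Ruv.
    rewrite le_spine leq_addr => /esym/tooth_le[z -> _].
    by exists z.
  - move=> [k a] z q q3 Ruv.
    have := Ro _ _ _ _ _ (le_trans q3 p3p) (Rm _ _ _ _ q3 Rp3) Ruv.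
    rewrite le_spine le_tooth eqxx r0P /= => nk.
    by exists ((k - n.+1)%N, a); rewrite /comb_shift /= subnKC.
have [q q3 Rq] := generically_rigid_transfer rT Hiso R3 (spine n.+1).
by exists q => //; exact: le_trans p3p.
Qed.

Lemma comb_generically_rigid : generically_rigid P (comb T).
Proof.
move=> p R Riso u; case: (combP u) => [[n ->]|[n [x ->]]].
  exact: comb_spine_fixed.
have [p1 p1p Rn] := comb_spine_fixed n Riso.
have [p2 p21 RSn] := comb_spine_fixed n.+1 (generic_iso_le p1p Riso).
have p2p := le_trans p21 p1p; have R2 := generic_iso_le p2p Riso.
have [Rm _ _ Ro] := Riso.
(* The [n]-th tooth is definable in the order from [spine n] and [spine n.+1], both fixed below
   [p2], so [R] preserves it. *)
have inT v : (exists x, v = tooth n x) <-> (spine n < v /\ ~~ (spine n.+1 <= v)).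
  case: (combP v) => [[k ->]|[k [y ->]]]; rewrite le_spine comb_ltE /=.
    by split=> [[]//|[-> ]].
  rewrite -leqNgt; split=> [[z [-> _]]|[nk kn]]; first by [].
  by exists y; congr tooth; apply/eqP; rewrite eqn_leq kn.
have key v w q : q <= p2 -> R v w q ->
    (exists x, v = tooth n x) <-> (exists x, w = tooth n x).
  move=> q2 Rvw; rewrite !inT.
  rewrite (generic_iso_lt (generic_iso_le q2 R2)
    (Rm _ _ _ _ (le_trans q2 p21) Rn) Rvw).
  by rewrite (Ro _ _ _ _ _ (le_trans q2 p2p) (Rm _ _ _ _ q2 RSn) Rvw).
have [] := rT (p := p2) (R := fun x y => R (tooth n x) (tooth n y)) _ x.
  apply: (generic_iso_restr (i := tooth n) (j := tooth n)) R2.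
  - by move=> y z; rewrite le_tooth eqxx.
  - by move=> y z; rewrite le_tooth eqxx.
  - by move=> y w q q2 /(key _ _ _ q2)[+ _]; apply; exists y.
  - by move=> v y q q2 /(key _ _ _ q2)[_]; apply; exists y.
by move=> q q2 Rq; exists q => //; exact: le_trans p2p.
Qed.

End CombRigid.

(** Conditions are now nodes of the comb. Each is extended by a node of the tooth of its index, and
    that tooth, in the reversed order, is a downward closed copy of [T^d]. *)
Lemma comb_absolutely_rigid {d : Order.disp_t} (T : porderType d) :
  (exists r : T, forall x, r <= x) -> absolutely_rigid T ->
  absolutely_rigid (comb T).
Proof.
move=> [r rP] /forced_rigidP /(comb_generically_rigid rP) rC.
apply/forced_rigidP; apply: generically_rigid_cone rC => u.
exists (tooth u.1) => [x y|]; first by rewrite !leEdual le_tooth eqxx.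
split; last by move=> x v /tooth_le[y -> _]; exists y.
case: (combP u) => [[n ->]|[n [x ->]]]; last by exists x.
by exists r; rewrite leEdual le_spine.
Qed.

Theorem theorem3p2 :
  (exists (d : Order.disp_t) (T : porderType d),
      souslin_tree T /\ absolutely_rigid T) ->
  exists (d : Order.disp_t) (T : porderType d),
    [/\ souslin_tree T, absolutely_rigid T & ~ totally_rigid T].
Proof.
move=> [d [T [sT aT]]]; exists d, (comb T); split.
- exact: comb_souslin.
- by apply: comb_absolutely_rigid aT; have [[_ []]] := sT.
- exact: comb_not_totally_rigid.
Qed.
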